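(* Let $K$ be a field and let $\mathcal{A}$ be a finitely generated unital $K$-algebra. If $\mathcal{A}$ has Gelfand-Kirillov dimension $1$, then $\mathcal{A}$ has only finitely many ends. Also, if the growth function $f$ of $\mathcal{A}$ relative to some finite generating system containing the unit satisfies $f(n)\leq Cn$ for all $n\ge 1$, then $\mathcal{A}$ has at most $C$ ends.
   Context: A $K$-linear subspace $V\subset\mathcal{A}$ is almost invariant if for every $x\in\mathcal{A}$ the quotient $(Vx+V)/V$ is finite dimensional over $K$. Ends: $\mathcal{A}$ has $k$ ends if $\mathcal{A}=V_1\oplus\dots\oplus V_k$ with all $V_i$ infinite dimensional almost invariant subspaces, but $\mathcal{A}$ cannot be written as the direct sum of $k+1$ infinite dimensional almost invariant subspaces. $\mathcal{A}$ has infinitely many ends if such a direct sum decomposition exists for every $k\geq 1$. By convention finite dimensional algebras have zero ends. Growth: let $t_1,\dots,t_q$ be a finite generating system of $\mathcal{A}$ containing the unit. Let $S_1$ be the $K$-span of $t_1,\dots,t_q$ and inductively $S_{n+1}=S_nS_1$ (the span of the products). The growth function of $\mathcal{A}$ relative to this generating system is $f(n)=\dim_K(S_n)$, and the Gelfand-Kirillov dimension is $\limsup_{n\to\infty}\frac{\log f(n)}{\log n}$, which does not depend on the choice of generators. *)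

(* Defs.v *)
(* MathComp / MathComp-Analysis. *)
From mathcomp Require Import all_boot all_order all_algebra.
From mathcomp Require Import all_classical all_reals all_analysis.

Set Implicit Arguments.
Unset Strict Implicit.
Unset Printing Implicit Defensive.

Import Order.TTheory GRing.Theory Num.Theory.
Local Open Scope classical_set_scope.
Local Open Scope ring_scope.

(* Linear algebra in a possibly infinite-dimensional module, where {vspace _}
   is not available: subspaces are classical sets. *)

Definition is_subspace (K : fieldType) (E : lmodType K) (V : set E) : Prop :=
  submod_closed (mem V).

Definition lspan (K : fieldType) (E : lmodType K) (X : set E) : set E :=
  smallest (@is_subspace K E) X.

Definition finite_dim (K : fieldType) (E : lmodType K) (V : set E) : Prop :=
  exists s : seq E, V = lspan [set` s].

Definition lin_indep (K : fieldType) (E : lmodType K) (s : seq E) : Prop :=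
  forall c : 'I_(size s) -> K,
    \sum_i c i *: s`_i = 0 -> forall i, c i = 0.

(* The default value 0 is used only when V has no finite basis. *)
Definition dimension (K : fieldType) (E : lmodType K) (V : set E) : nat :=
  xget 0%N [set n | exists s : seq E,
    [/\ size s = n, lin_indep s & V = lspan [set` s]]].

(* For V a subspace of W, W / V is spanned by the classes of finitely many
   elements of W. *)
Definition finite_dim_quotient (K : fieldType) (E : lmodType K)
    (W V : set E) : Prop :=
  exists2 s : seq E, [set` s] `<=` W &
    forall w, W w -> exists2 u, lspan [set` s] u & V (w - u).

(* E is the internal direct sum of the V i. *)
Definition is_direct_sum (K : fieldType) (E : lmodType K) (k : nat)
    (V : 'I_k -> set E) : Prop :=
  forall a : E, exists! v : {ffun 'I_k -> E},
    (forall i, V i (v i)) /\ a = \sum_i v i.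

(* Ends. In [algType K] the ring is unital and 1 != 0. *)

Definition almost_invariant (K : fieldType) (A : algType K) (V : set A) : Prop :=
  is_subspace V /\
  forall x : A,
    finite_dim_quotient [set v * x + w | v in V & w in V] V.

Definition ends_decomposition (K : fieldType) (A : algType K) (k : nat) : Prop :=
  exists V : 'I_k -> set A,
    [/\ forall i, almost_invariant (V i),
        forall i, ~ finite_dim (V i)
      & is_direct_sum V].

Definition has_ends (K : fieldType) (A : algType K) (k : nat) : Prop :=
  if k is 0 then finite_dim [set: A]
  else ends_decomposition A k /\ ~ ends_decomposition A k.+1.

(* This excludes that [ends_decomposition A k] holds for every k >= 1. *)
Definition finitely_many_ends (K : fieldType) (A : algType K) : Prop :=
  exists k : nat, has_ends A k.

Definition at_most_ends (R : realType) (K : fieldType) (A : algType K) (C : R) :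
    Prop :=
  finitely_many_ends A /\ forall k : nat, has_ends A k -> k%:R <= C.

(* Growth. *)

Definition alg_generated_by (K : fieldType) (A : algType K) (s : seq A) : Prop :=
  smallest (fun B : set A => subalg_closed (mem B)) [set` s] = [set: A].

Definition finitely_generated (K : fieldType) (A : algType K) : Prop :=
  exists s : seq A, alg_generated_by s.

Definition generating_system (K : fieldType) (A : algType K) (s : seq A) : Prop :=
  1 \in s /\ alg_generated_by s.

(* S_n for n >= 1; the value at n = 0 is irrelevant. *)
Definition growth_space (K : fieldType) (A : algType K) (s : seq A) (n : nat) :
    set A :=
  let S1 := lspan [set` s] in
  iter n.-1 (fun V : set A => lspan [set x * y | x in V & y in S1]) S1.

Definition growth (K : fieldType) (A : algType K) (s : seq A) (n : nat) : nat :=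
  dimension (growth_space s n).

Definition growth_exponent (R : realType) (K : fieldType) (A : algType K)
    (s : seq A) : \bar R :=
  limn_esup (fun n : nat => (ln (growth s n)%:R / ln n%:R)%:E).

(* The exponent does not depend on the generating system, so asking for some
   generating system is the same as asking for all of them. *)
Definition has_GKdim (R : realType) (K : fieldType) (A : algType K)
    (d : \bar R) : Prop :=
  exists2 s : seq A, generating_system s & growth_exponent R s = d.

(* Main.v *)
Require Import Defs.
From mathcomp Require Import all_boot all_order all_algebra.
From mathcomp Require Import all_classical all_reals all_analysis.
From mathcomp Require Import zify lra.

Set Implicit Arguments.
Unset Strict Implicit.
Unset Printing Implicit Defensive.

Import Order.TTheory GRing.Theory Num.Theory.

(* Let p_i be the projections of a decomposition of A into k infinite
   dimensional almost invariant subspaces V_i. Almost invariance says that p_i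
   commutes with right multiplication by the generators up to a fixed finite
   dimensional space, contained in some S_m. Hence p_i(S_n) lies in S_(n+m), and
   the spaces p_i(S_n) grow strictly for n >= m: if two consecutive ones agree,
   then all later ones agree and V_i is finite dimensional. Counting dimensions,
   k n <= f(n + 2m + 1), so f(n) <= C n forces k <= C.

   The case of Gelfand-Kirillov dimension 1 reduces to linear growth by
   Bergman's gap theorem. The normal words (those whose value is not spanned by values of
   length-lexicographically smaller words) form a factor closed language and
   those of length at most n give a basis of S_n. If for every d there are more
   than d normal words of length d, then f(n) >= n^2 / 2. Otherwise, fixing d
   with at most d normal words of length d, every normal word of length n >= 2d has a
   period p <= d outside its first and last d letters, so there are at most d^3
   normal words of length n. *)

(** * Languages with few factors *)

Lemma pigeonhole_nat (T : eqType) (F : nat -> T) (D : seq T) (c d : nat) :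
  size D <= d -> (forall i, c <= i <= c + d -> F i \in D) ->
  exists i j, [/\ c <= i, i < j, j <= c + d & F i = F j].
Proof.
move=> sD FD; have /uniqPn: ~~ uniq [seq F i | i <- iota c d.+1].
  apply/negP => u; have : size [seq F i | i <- iota c d.+1] <= size D.
    apply: uniq_leq_size => // x /mapP[i]; rewrite mem_iota addnS ltnS => hi ->.
    exact: FD.
  by rewrite size_map size_iota; lia.
move=> /(_ (F c))[i [j [ij]]]; rewrite size_map size_iota => jd.
rewrite !(nth_map 0) ?size_iota ?nth_iota ?(ltn_trans ij jd)// => Fij.
by exists (c + i), (c + j); split=> //; lia.
Qed.

(* In a run of period [p] all windows of length [p] contain the same letters;
   the window ending at the first letter violating the period does not. *)
Lemma window_breaking_period (T : eqType) (y : nat -> T) (a b p c : nat) :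
  (forall t, a + p <= t < b -> y t = y (t - p)) ->
  a + p <= b -> y b != y (b - p) -> a <= c -> c + p <= b ->
  ~ (forall k, k < p -> y (b - p + 1 + k) = y (c + k)).
Proof.
move=> per apb yb ac cb eqw.
(* Sliding the window along the run trades a letter for an equal one, so [N] is constant there; the
   slide that brings in [y b] raises it by one. *)
pose N c := \sum_(0 <= k < p) (y (c + k) == y b).
have shift u : N u.+1 + (y u == y b) = N u + (y (u + p) == y b).
  transitivity (\sum_(0 <= k < p.+1) (y (u + k) == y b)).
    rewrite big_nat_recl // addn0 addnC; congr (_ + _); apply: eq_big_nat => k _.
    by rewrite addSnnS.
  by rewrite big_nat_recr.
have const u : a <= u -> u + p <= b -> N u = N a.
  elim: u => [|u IH] au ub; first by move: au; rewrite leqn0 => /eqP <-.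
  have [->//|ne] := eqVneq a u.+1.
  have := shift u; rewrite (per (u + p)); last by lia.
  by rewrite addnK => /addIn ->; apply: IH; lia.
have := shift (b - p); rewrite subnK ?eqxx; last by lia.
rewrite eq_sym (negbTE yb) addn0 (const (b - p)) -?(const c) //; try lia.
suff -> : N (b - p).+1 = N c by lia.
by apply: eq_big_nat => k kp; rewrite -addn1 eqw.
Qed.

(* With [p] the smallest recurrence distance of a factor of length [d] near the
   start of [y], the run of period [p] extends almost to the end: its first
   breaking letter [b] would be covered by [d + 1] distinct factors. *)
Lemma few_factors_periodic (T : eqType) (y : nat -> T) (n d : nat)
    (D : seq (seq T)) :
  size D <= d -> d.*2 <= n ->
  (forall i, i + d <= n -> mkseq (fun k => y (i + k)) d \in D) ->
  exists2 p, 0 < p <= d & forall t, d <= t -> t + d <= n -> y t = y (t - p).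
Proof.
move=> sD dn FD; pose F i := mkseq (fun k => y (i + k)) d.
have FE i j : F i = F j <-> forall k, k < d -> y (i + k) = y (j + k).
  split=> [Fij k kd|H]; last first.
    by apply/eq_in_map => k; rewrite mem_iota => /andP[_ ?]; apply: H.
  by have := congr1 (fun s => nth (y 0) s k) Fij; rewrite !nth_mkseq.
pose rec p :=
  (0 < p) && has (fun a => (a + p <= d) && (F a == F (a + p))) (iota 0 d.+1).
have recP p a : 0 < p -> a + p <= d -> F a = F (a + p) -> rec p.
  move=> p0 ap Fa; rewrite /rec p0.
  apply/hasP; exists a; last by rewrite ap Fa eqxx.
  by rewrite mem_iota; lia.
have ex_rec : exists p, rec p.
  have [|i [j [_ ij jd Fij]]] := @pigeonhole_nat _ F D 0 d sD.
    by move=> i id; apply: FD; lia.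
  by exists (j - i); apply: (recP _ i); rewrite ?subnKC //; lia.
case: (ex_minnP ex_rec) => p /andP[p0 /hasP[a _ /andP[apd /eqP Fa]]] pmin.
exists p => [|t dt tn]; first by lia.
pose bad b := [&& a + p <= b, b + d <= n & y b != y (b - p)].
have [//|ytp] := eqVneq (y t) (y (t - p)); exfalso.
have ex_bad : exists b, bad b by exists t; rewrite /bad ytp; lia.
case: (ex_minnP ex_bad) => b /and3P[apb bn yb] bmin.
have per u : a + p <= u < b -> y u = y (u - p).
  move=> ub; apply/eqP; apply/negPn/negP => yu.
  by have := bmin u; rewrite /bad yu; lia.
(* An earlier break would lie inside the factor at [a + p], which is a copy of the factor at [a]. *)
have run : a + p + d <= b.
  rewrite leqNgt; apply/negP => lt; move: yb; rewrite eq_sym => /eqP; apply.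
  have /FE /(_ (b - p - a)) := Fa.
  have -> : a + (b - p - a) = b - p by lia.
  have -> : a + p + (b - p - a) = b by lia.
  by apply; lia.
have perM k u : a <= u -> u + k * p < b -> y (u + k * p) = y u.
  move=> au; elim: k => [|k IH] ub; first by rewrite addn0.
  rewrite per; last by rewrite mulSn; lia.
  by rewrite -IH; [congr y|]; rewrite mulSn in ub *; lia.
have [|i [j [ci ij jd Fij]]] := @pigeonhole_nat _ F D (b - d - p + 1) d sD.
  by move=> i id; apply: FD; lia.
have {}Fij := (FE i j).1 Fij.
(* If the later factor covers [b], it contains the window of length [p] ending at [b], whose copy in
   the earlier factor lies in the run. *)
have [jb|bj] := leqP (j + d) b; last first.
  apply: (@window_breaking_period _ y a b p (i + (b - p + 1 - j))) => //; try lia.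
  move=> k kp.
  have -> : b - p + 1 + k = j + (b - p + 1 - j + k) by lia.
  by rewrite -Fij ?addnA //; lia.
(* Both factors lie in the run, so their distance [q < p] is a period of it,
   against the minimality of [p]. *)
pose q := j - i.
suff : rec q by move=> /pmin; rewrite /q; lia.
apply: (recP _ a); rewrite /q; try lia.
apply/FE => l ld.
(* Since [p <= d], some multiple of [p] moves the letter into the factor at [i]; the quotient below
   is rounded up. *)
have [k ks] : exists k, i <= a + l + k * p < i + d.
  have [il|li] := leqP i (a + l); first by exists 0; lia.
  exists ((i - (a + l) + p.-1) %/ p).
  have := divn_eq (i - (a + l) + p.-1) p.
  by have := ltn_pmod (i - (a + l) + p.-1) p0; lia.
rewrite -(perM k (a + l)) -?(perM k (a + (j - i) + l)); try lia.
have -> : a + (j - i) + l + k * p = j + (a + l + k * p - i) by lia.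
by rewrite -Fij ?subnKC //; lia.
Qed.

(** A word with few factors is recovered from its period and its first and last [d] letters, and
    each of these three has at most [d] possible values. *)
Lemma factor_closed_bound (T : eqType) (P : seq T -> Prop) (d n : nat)
    (D W : seq (seq T)) :
  (forall u v w, P (u ++ v ++ w) -> P v) ->
  (forall w, P w -> size w = d -> w \in D) -> size D <= d ->
  uniq W -> (forall w, w \in W -> P w /\ size w = n) -> d.*2 <= n ->
  size W <= d ^ 3.
Proof.
move=> Pf PD sD uW WP dn.
have [-> //|[w0 w0W]] : W = [::] \/ exists w, w \in W.
  by case: W {uW WP} => [|w W]; [left | right; exists w; rewrite mem_head].
have factD w i : w \in W -> i + d <= n -> take d (drop i w) \in D.
  move=> /WP[Pw sw] idn; apply: PD; last by rewrite size_takel // size_drop; lia.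
  apply: (Pf (take i w) _ (drop d (drop i w))).
  by rewrite cat_take_drop cat_take_drop.
(* A default letter for [nth]. If [w0] is empty, then [d = 0] and [D] is empty, yet [D] must contain
   the empty factor. *)
have [x0] : exists x0 : T, True.
  case: (w0) (w0W) => [|x ? _]; last by exists x.
  move=> w0W'; have [_ /= n0] := WP _ w0W'; have := factD _ 0 w0W'; move: sD.
  have -> : d = 0 by lia.
  by rewrite leqn0 => /nilP ->; rewrite leq0n => /(_ isT).
move=> _.
have /choice[p pP] w : exists p, w \in W -> 0 < p <= d /\
    forall t, d <= t -> t + d <= n -> nth x0 w t = nth x0 w (t - p).
  have [wW|] := boolP (w \in W); last by exists 0.
  have [|p] := @few_factors_periodic _ (nth x0 w) n d D sD dn.
    move=> i idn; have [_ sw] := WP _ wW.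
    suff -> : mkseq (fun k => nth x0 w (i + k)) d = take d (drop i w).
      exact: factD.
    apply/esym; apply: (eq_from_nth (x0 := x0)).
      by rewrite size_mkseq size_takel // size_drop; lia.
    rewrite size_takel ?size_drop; last by lia.
    by move=> k kd; rewrite nth_take // nth_drop nth_mkseq.
  by exists p.
pose g w := (p w, (take d w, drop (n - d) w)).
pose G := [seq (i, uv) | i <- iota 1 d, uv <- [seq (u, v) | u <- D, v <- D]].
suff : size (map g W) <= size G.
  rewrite !size_map !size_allpairs size_iota => /leq_trans; apply.
  by rewrite expnS leq_mul // -mulnn leq_mul.
apply: uniq_leq_size => [|x /mapP[w wW ->]]; last first.
  apply: allpairs_f; first by rewrite mem_iota; have [] := pP w wW; lia.
  have [_ sw] := WP _ wW.
  apply: allpairs_f; first by have := factD w 0 wW; rewrite drop0; apply; lia.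
  have := factD w (n - d) wW; rewrite take_oversize ?size_drop; last by lia.
  by apply; lia.
rewrite map_inj_in_uniq // => w w' wW w'W [pw tw dw].
have [_ sw] := WP _ wW; have [_ sw'] := WP _ w'W.
apply: (@eq_from_nth _ x0) => [|t]; rewrite sw ?sw' //.
elim/ltn_ind: t => t IH tn.
have [td|dt] := ltnP t d.
  by rewrite -(nth_take _ td) tw nth_take.
have [tdn|ndt] := leqP (t + d) n; last first.
  have -> : t = n - d + (t - (n - d)) by lia.
  by rewrite -!nth_drop dw.
have [p0 ->//] := pP w wW; have [_ ->//] := pP w' w'W.
by rewrite -pw IH //; lia.
Qed.

Local Open Scope classical_set_scope.
Local Open Scope ring_scope.

(** * Linear algebra *)

Lemma is_subspaceP (K : fieldType) (E : lmodType K) (V : set E) :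
  is_subspace V <-> V 0 /\ forall a u v, V u -> V v -> V (a *: u + v).
Proof.
split=> [[V0 VL]|[V0 VL]].
  split=> [|a u v Vu Vv]; first by move: V0; rewrite inE.
  by have := VL a u v; rewrite !inE; apply.
by split=> [|a u v]; rewrite !inE //; apply: VL.
Qed.

Lemma subspace0 (K : fieldType) (E : lmodType K) (V : set E) :
  is_subspace V -> V 0.
Proof. by move=> /is_subspaceP[]. Qed.

Lemma subspaceD (K : fieldType) (E : lmodType K) (V : set E) (u v : E) :
  is_subspace V -> V u -> V v -> V (u + v).
Proof. by move=> /is_subspaceP[_ VL] Vu Vv; rewrite -(scale1r u); apply: VL. Qed.

Lemma subspaceZ (K : fieldType) (E : lmodType K) (V : set E)
    (sV : is_subspace V) (a : K) (u : E) : V u -> V (a *: u).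
Proof.
have /is_subspaceP[V0 VL] := sV.
by move=> Vu; rewrite -(addr0 (a *: u)); apply: VL.
Qed.

Lemma subspaceB (K : fieldType) (E : lmodType K) (V : set E) (u v : E) :
  is_subspace V -> V u -> V v -> V (u - v).
Proof.
by move=> sV Vu Vv; apply: subspaceD => //; rewrite -scaleN1r; apply: subspaceZ.
Qed.

Lemma subspace_sum (K : fieldType) (E : lmodType K) (V : set E)
    (sV : is_subspace V) (I : Type) (r : seq I) (P : pred I) (f : I -> E) :
  (forall i, P i -> V (f i)) -> V (\sum_(i <- r | P i) f i).
Proof.
move=> Vf; elim/big_ind: _ => //; first exact: subspace0.
by move=> u v; apply: subspaceD.
Qed.

Lemma subspace_preimage (K : fieldType) (E F : lmodType K) (f : E -> F)
    (V : set F) : linear f -> is_subspace V -> is_subspace (f @^-1` V).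
Proof.
move=> fL /is_subspaceP[V0 VL]; apply/is_subspaceP; split=> [|a u v] /=.
  by have := fL (-1) 0 0; rewrite scaler0 addr0 scaleN1r addNr => ->.
by rewrite fL; apply: VL.
Qed.

Lemma subspace_image (K : fieldType) (E F : lmodType K) (f : E -> F)
    (V : set E) : linear f -> is_subspace V -> is_subspace (f @` V).
Proof.
move=> fL /is_subspaceP[V0 VL]; apply/is_subspaceP; split.
  by exists 0 => //; have := fL (-1) 0 0; rewrite scaler0 addr0 scaleN1r addNr.
move=> a _ _ [u Vu <-] [v Vv <-]; exists (a *: u + v); first exact: VL.
by rewrite fL.
Qed.

Lemma lspan_subspace (K : fieldType) (E : lmodType K) (X : set E) :
  is_subspace (lspan X).
Proof.
apply/is_subspaceP; split=> [|a u v Xu Xv] B [sB XB]; first exact: subspace0.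
by move/is_subspaceP: (sB) => [_]; apply; [apply: Xu | apply: Xv].
Qed.

Lemma lspan_sub (K : fieldType) (E : lmodType K) (X V : set E) :
  is_subspace V -> X `<=` V -> lspan X `<=` V.
Proof. exact: smallest_sub. Qed.

Lemma lspan_mono (K : fieldType) (E : lmodType K) (X Y : set E) :
  X `<=` Y -> lspan X `<=` lspan Y.
Proof.
move=> XY; apply: lspan_sub; first exact: lspan_subspace.
by apply: subset_trans XY _; apply: sub_gen_smallest.
Qed.

Lemma lspan_seqP (K : fieldType) (E : lmodType K) (s : seq E) (x : E) :
  lspan [set` s] x <-> exists c : 'I_(size s) -> K, x = \sum_i c i *: s`_i.
Proof.
split=> [|[c ->]]; last first.
  apply: (subspace_sum (lspan_subspace _)) => i _.
  apply: (subspaceZ (lspan_subspace _)).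
  by apply: sub_gen_smallest; rewrite /= mem_nth.
pose V := [set x : E | exists c : 'I_(size s) -> K, x = \sum_i c i *: s`_i].
apply: (@lspan_sub _ _ _ V) => [|y /= ys].
  apply/is_subspaceP; split=> [|a u v [c ->] [c' ->]].
    by exists (fun=> 0); rewrite big1 // => i _; rewrite scale0r.
  exists (fun i => a * c i + c' i); rewrite scaler_sumr -big_split /=.
  by apply: eq_bigr => i _; rewrite scalerA scalerDl.
have ys' : (index y s < size s)%N by rewrite index_mem.
exists (fun i => (i == Ordinal ys')%:R).
rewrite (bigD1 (Ordinal ys')) //= eqxx scale1r nth_index // big1 ?addr0 //.
by move=> i /negbTE ->; rewrite scale0r.
Qed.

Definition free_family (K : fieldType) (E : lmodType K) (I : finType)
    (e : I -> E) : Prop :=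
  forall c : I -> K, \sum_i c i *: e i = 0 -> forall i, c i = 0.

(** A vector in the left kernel of the coordinate matrix is a linear relation between the [e i]; so
    the rows are independent, and the rank is at most the number of columns. *)
Lemma free_family_leq (K : fieldType) (E : lmodType K) (I : finType)
    (e : I -> E) (t : seq E) :
  free_family e -> (forall i, lspan [set` t] (e i)) -> (#|I| <= size t)%N.
Proof.
move=> fe te; have /choice[M eM] i := (lspan_seqP t (e i)).1 (te i).
pose A := \matrix_(i < #|I|, j < size t) M (enum_val i) j.
suff : row_free A by move=> /eqP <-; apply: rank_leq_col.
rewrite -kermx_eq0; apply/rowV0P => v /sub_kermxP vA.
apply/rowP => i; rewrite mxE.
suff : v 0 (enum_rank (enum_val i)) = 0 by rewrite enum_valK.
apply: (fe (fun x => v 0 (enum_rank x))) => {i}.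
transitivity (\sum_j (\sum_i v 0 (enum_rank i) * M i j) *: t`_j).
  under eq_bigr do rewrite eM scaler_sumr.
  rewrite exchange_big; apply: eq_bigr => j _; rewrite scaler_suml.
  by apply: eq_bigr => i _; rewrite scalerA.
rewrite big1 // => j _; have /rowP/(_ j) := vA; rewrite !mxE => vAj.
rewrite (reindex_onto enum_val enum_rank) /=; last by move=> x _; rewrite enum_rankK.
rewrite [X in X *: _](_ : _ = 0) ?scale0r // -[RHS]vAj.
apply: eq_big => [x|x _]; first by rewrite enum_valK eqxx.
by rewrite enum_valK mxE.
Qed.

Lemma lspan_cons (K : fieldType) (E : lmodType K) (y : E) (s : seq E) :
  lspan [set` s] y -> lspan [set` y :: s] = lspan [set` s].
Proof.
move=> sy; apply/seteqP; split; last first.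
  by apply: lspan_mono => z /= zs; rewrite inE zs orbT.
apply: lspan_sub => [|z /=]; first exact: lspan_subspace.
by rewrite inE => /predU1P[->//|zs]; apply: sub_gen_smallest.
Qed.

Lemma lspan_basis (K : fieldType) (E : lmodType K) (s : seq E) :
  exists2 b : seq E, lin_indep b & lspan [set` s] = lspan [set` b].
Proof.
elim: s => [|y s [b fb sb]]; first by exists [::] => // c _ [].
have [by_|nby] := pselect (lspan [set` b] y).
  by exists b; rewrite // lspan_cons sb.
exists (y :: b) => [c|]; last first.
  apply/seteqP; split; apply: lspan_sub; try exact: lspan_subspace.
    move=> z /=; rewrite inE => /predU1P[->|zs].
      by apply: sub_gen_smallest; rewrite /= mem_head.
    apply: (@lspan_mono _ _ [set` b]) => [w /= wb|]; first by rewrite inE wb orbT.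
    by rewrite -sb; apply: sub_gen_smallest.
  move=> z /=; rewrite inE => /predU1P[->|zb].
    by apply: sub_gen_smallest; rewrite /= mem_head.
  apply: (@lspan_mono _ _ [set` s]) => [w /= wb|]; first by rewrite inE wb orbT.
  by rewrite sb; apply: sub_gen_smallest.
rewrite big_ord_recl /= => c0.
have c00 : c ord0 = 0.
  apply: contrapT => /eqP cn0; apply: nby.
  rewrite -(scale1r y) -(mulVf cn0) -scalerA.
  apply: (subspaceZ (lspan_subspace _)).
  move/eqP: c0; rewrite addr_eq0 => /eqP ->; rewrite -scaleN1r.
  apply: (subspaceZ (lspan_subspace _)); apply/lspan_seqP.
  by exists (fun i => c (lift ord0 i)).
move: c0; rewrite c00 scale0r add0r => /fb c0 i.
by case: (unliftP ord0 i) => [j ->|->].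
Qed.

Lemma dimension_basis (K : fieldType) (E : lmodType K) (V : set E) :
  finite_dim V -> exists b : seq E,
    [/\ size b = dimension V, lin_indep b & V = lspan [set` b]].
Proof.
move=> [s Vs]; rewrite /dimension.
have [b fb sb] := lspan_basis s.
by case: xgetP => [//|/(_ (size b))[]]; exists b; rewrite Vs.
Qed.

Lemma dimension_ge (K : fieldType) (E : lmodType K) (V : set E) (I : finType)
    (e : I -> E) :
  finite_dim V -> free_family e -> (forall i, V (e i)) -> (#|I| <= dimension V)%N.
Proof.
move=> /dimension_basis[b [<- _ Vb]] fe Ve.
by apply: free_family_leq fe _ => i; rewrite -Vb.
Qed.

Lemma dimension_le (K : fieldType) (E : lmodType K) (V : set E) (t : seq E) :
  V `<=` lspan [set` t] -> (dimension V <= size t)%N.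
Proof.
move=> Vt; rewrite /dimension; case: xgetP => [_ -> [b [<- fb Vb]]|//].
rewrite -[size b]card_ord; apply: (free_family_leq fb) => i.
by apply: Vt; rewrite Vb; apply: sub_gen_smallest; rewrite /= mem_nth.
Qed.

(** In a vanishing combination, the term of highest rank with nonzero coefficient would be a
    combination of terms of lower rank, hence lie in its own [U]. *)
Lemma free_family_filtration (K : fieldType) (E : lmodType K) (I : finType)
    (e : I -> E) (r : I -> nat) (U : nat -> set E) :
  injective r -> (forall n, is_subspace (U n)) ->
  (forall i j, (r i < r j)%N -> U (r j) (e i)) -> (forall i, ~ U (r i) (e i)) ->
  free_family e.
Proof.
move=> rI sU eU eNU c c0 i; apply: contrapT => /eqP ci.
have [j cj jmax] := @arg_maxnP _ i (fun j => c j != 0) r ci.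
apply: (eNU j); rewrite -(scale1r (e j)) -(mulVf cj) -scalerA.
apply: (subspaceZ (sU _)).
move/eqP: c0; rewrite (bigD1 j) //= addr_eq0 => /eqP ->; rewrite -scaleN1r.
apply: (subspaceZ (sU _)); apply: (subspace_sum (sU _)) => l lj.
have [->|cl] := eqVneq (c l) 0; first by rewrite scale0r; apply: subspace0.
apply: (subspaceZ (sU _)); apply: eU.
by rewrite ltn_neqAle (inj_eq rI) lj; apply: jmax.
Qed.

(** * Normal words and growth *)

(* Digits are nonzero, so that the order of the codes is the
   length-lexicographic order of the words. *)
Definition code (q : nat) (w : seq 'I_q) : nat :=
  foldl (fun c (i : 'I_q) => c * q.+1 + i.+1)%N 0%N w.

Lemma code_rcons (q : nat) (w : seq 'I_q) (i : 'I_q) :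
  code (rcons w i) = (code w * q.+1 + i.+1)%N.
Proof. by rewrite /code -cats1 foldl_cat. Qed.

Lemma code_cat (q : nat) (u v : seq 'I_q) :
  code (u ++ v) = (code u * q.+1 ^ size v + code v)%N.
Proof.
elim/last_ind: v => [|v i IH]; first by rewrite cats0 muln1 addn0.
by rewrite -rcons_cat !code_rcons IH size_rcons expnS; lia.
Qed.

Lemma code_ltn (q : nat) (w : seq 'I_q) : (code w < q.+1 ^ size w)%N.
Proof.
elim/last_ind: w => // w i IH; rewrite code_rcons size_rcons expnS.
by have := ltn_ord i; nia.
Qed.

Lemma code_geq (q : nat) (w : seq 'I_q) :
  w != [::] -> (q.+1 ^ (size w).-1 <= code w)%N.
Proof.
elim/last_ind: w => // w i IH _; rewrite code_rcons size_rcons /=.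
have [->//|/[dup] wn /IH] := eqVneq w [::].
have -> : size w = (size w).-1.+1 by case: (w) wn.
by move=> IHw; rewrite expnSr (leq_trans _ (leq_addr _ _)) // leq_mul2r IHw orbT.
Qed.

Lemma code_inj (q : nat) : injective (@code q).
Proof.
elim/last_ind=> [|u i IH] v; elim/last_ind: v => [|v j _] //; rewrite !code_rcons.
- by move=> /eqP; rewrite addnS.
- by move=> /eqP; rewrite addnS.
move=> uv; have ij : val i = val j.
  have := congr1 (modn^~ q.+1) uv; rewrite !modnMDl !modn_small ?ltnS //.
  by case.
rewrite (val_inj ij) (IH v) //.
by move: uv; rewrite ij => /addIn /eqP; rewrite eqn_pmul2r // => /eqP.
Qed.

Lemma code_size (q : nat) (u v : seq 'I_q) :
  (code u < code v)%N -> (size u <= size v)%N.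
Proof.
move=> uv; rewrite leqNgt; apply/negP => vu; move: uv; apply/negP; rewrite -leqNgt.
have un : u != [::] by case: u vu.
apply: leq_trans (code_geq un); apply: (leq_trans (ltnW (code_ltn v))).
by rewrite leq_pexp2l //; lia.
Qed.

(** By [code_size], [u] is no longer than [v], so [x] is shifted no further in the first word. The
    order is thus compatible with products, like a monomial order. *)
Lemma code_cat_ltn (q : nat) (x u v y : seq 'I_q) :
  (code u < code v)%N -> (code (x ++ u ++ y) < code (x ++ v ++ y))%N.
Proof.
move=> uv; rewrite !code_cat !size_cat.
have sle : (q.+1 ^ (size u + size y) <= q.+1 ^ (size v + size y))%N.
  by rewrite leq_pexp2l // leq_add2r code_size.
have : (0 < q.+1 ^ size y)%N by rewrite expn_gt0.
move: sle uv; move: (q.+1 ^ (size u + size y))%N (q.+1 ^ (size v + size y))%N.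
move: (q.+1 ^ size y)%N => b m n mn uv b0.
by rewrite -addnS leq_add ?leq_mul // ltn_add2r ltn_pmul2r.
Qed.

Section NormalWords.
Context (K : fieldType) (A : algType K) (s : seq A).
Notation word := (seq 'I_(size s)).

Definition word_val (w : word) : A := \prod_(i <- w) s`_i.

Definition normal (w : word) : Prop :=
  ~ lspan [set word_val u | u in [set u : word | (code u < code w)%N]]
      (word_val w).

Lemma word_val_cat (u v : word) : word_val (u ++ v) = word_val u * word_val v.
Proof. by rewrite /word_val big_cat. Qed.

(** Multiplying an expression of [v] through smaller words by [u] and [w] expresses the whole word
    through smaller words. *)
Lemma normal_factor (u v w : word) : normal (u ++ v ++ w) -> normal v.
Proof.
move=> nuvw nv; apply: nuvw.
pose f (a : A) := word_val u * (a * word_val w).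
have fL : linear f.
  by move=> a b c; rewrite /f mulrDl mulrDr -scalerAl -scalerAr.
have sL := lspan_subspace
  [set word_val u' | u' in [set u' : word | (code u' < code (u ++ v ++ w))%N]].
rewrite 2!word_val_cat.
have /lspan_sub := subspace_preimage fL sL.
apply; last exact: nv.
move=> _ [t tv <-]; rewrite /preimage /= /f -!word_val_cat.
by apply: sub_gen_smallest; exists (u ++ t ++ w) => //; apply: code_cat_ltn.
Qed.

(** Induction on the code: a word that is not normal is rewritten through smaller words, which are
    no longer than it. *)
Lemma normal_span (w : word) :
  lspan [set word_val u | u in [set u | normal u /\ (size u <= size w)%N]]
    (word_val w).
Proof.
have [n] := ubnP (code w); elim: n w => // n IH w; rewrite ltnS => wn.
have [nw|/contrapT nw] := pselect (normal w).
  by apply: sub_gen_smallest; exists w.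
apply: lspan_sub nw; first exact: lspan_subspace.
move=> _ [u /= uw <-].
apply: lspan_mono (IH u (leq_trans uw wn)) => _ [v [nv vu] <-].
by exists v => //; split=> //; apply: (leq_trans vu); apply: code_size.
Qed.

(** Filtration by codes: normality keeps each value outside the span of the values of smaller
    words. *)
Lemma normal_free (W : seq word) :
  (forall w, w \in W -> normal w) ->
  free_family (fun w : seq_sub W => word_val (ssval w)).
Proof.
move=> nW.
apply: (@free_family_filtration _ _ _ _ (fun w => code (ssval w))
  (fun n => lspan [set word_val u | u in [set u : word | (code u < n)%N]])).
- by move=> u v /code_inj /val_inj.
- by move=> n; apply: lspan_subspace.
- by move=> i j ij; apply: sub_gen_smallest; exists (ssval i).
- by move=> i; apply: nW; apply: ssvalP.
Qed.

(** Left multiplication is linear, so right factors need only range over the generators; this is the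
    induction step for inclusions of growth spaces. Indices are successors because
    [growth_space s 0] equals [growth_space s 1]. *)
Lemma growth_space_min (n : nat) (V : set A) : is_subspace V ->
  (forall x y, growth_space s n.+1 x -> y \in s -> V (x * y)) ->
  growth_space s n.+2 `<=` V.
Proof.
move=> sV Vxy; apply: lspan_sub => // _ [x Sx [y Sy <-]].
have mulL : linear (fun y => x * y) by move=> a u v; rewrite mulrDr scalerAr.
apply: (lspan_sub (subspace_preimage mulL sV)) Sy => z /= zs.
exact: Vxy.
Qed.

Lemma growth_space_subspace (n : nat) : is_subspace (growth_space s n.+1).
Proof. by case: n => [|n]; apply: lspan_subspace. Qed.

Lemma growth_space_mul (n : nat) (x y : A) :
  growth_space s n.+1 x -> y \in s -> growth_space s n.+2 (x * y).
Proof.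
move=> Sx ys; apply: sub_gen_smallest; exists x => //; exists y => //.
exact: sub_gen_smallest.
Qed.

Lemma growth_space_mono (m n : nat) :
  1 \in s -> (m <= n)%N -> growth_space s m.+1 `<=` growth_space s n.+1.
Proof.
move=> s1 /subnKC <-; elim: (n - m)%N => [|k IH]; first by rewrite addn0.
rewrite addnS => x /IH Sx; rewrite -(mulr1 x); exact: growth_space_mul.
Qed.

Lemma word_val_growth (w : word) (n : nat) :
  1 \in s -> (size w <= n.+1)%N -> growth_space s n.+1 (word_val w).
Proof.
move=> s1; elim/last_ind: w n => [|w i IH] n.
  move=> _; apply: (growth_space_mono s1 (leq0n n)).
  by rewrite /word_val big_nil; apply: sub_gen_smallest.
rewrite size_rcons ltnS /word_val -cats1 big_cat big_seq1 /=.
have si : s`_i \in s by rewrite mem_nth.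
case: n => [|n wn]; last by apply: growth_space_mul => //; apply: IH.
rewrite leqn0 => /nilP ->; rewrite big_nil mul1r; exact: sub_gen_smallest.
Qed.

Lemma growth_space_words (n : nat) :
  growth_space s n.+1 `<=`
    lspan [set word_val w | w in [set w : word | size w = n.+1]].
Proof.
elim: n => [|n IH].
  apply: lspan_sub => [|x /= xs]; first exact: lspan_subspace.
  apply: sub_gen_smallest; have xi : (index x s < size s)%N by rewrite index_mem.
  by exists [:: Ordinal xi]; rewrite // /word_val big_seq1 /= nth_index.
apply: growth_space_min => [|x y /IH Sx ys]; first exact: lspan_subspace.
have mulL : linear (fun z => z * y) by move=> a u v; rewrite mulrDl scalerAl.
apply: (lspan_sub (subspace_preimage mulL (lspan_subspace _))) Sx.
move=> _ [w wn <-]; apply: sub_gen_smallest.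
have yi : (index y s < size s)%N by rewrite index_mem.
exists (rcons w (Ordinal yi)); first by rewrite /= size_rcons wn.
by rewrite /word_val -cats1 big_cat big_seq1 /= nth_index.
Qed.

Definition normal_words (n : nat) : seq word :=
  [seq w <- map val (enum {: n.-tuple 'I_(size s)}) | `[< normal w >]].

Lemma normal_wordsP (n : nat) (w : word) :
  w \in normal_words n <-> normal w /\ size w = n.
Proof.
rewrite mem_filter; split=> [/andP[/asboolP nw /mapP[t _ wt]]|[nw <-]].
  by split=> //; rewrite wt; apply: size_tuple.
apply/andP; split; first exact/asboolP.
by apply/mapP; exists (in_tuple w); rewrite ?mem_enum.
Qed.

Lemma normal_words_uniq (n : nat) : uniq (normal_words n).
Proof. by rewrite filter_uniq // map_inj_uniq ?enum_uniq //; apply: val_inj. Qed.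

Fixpoint normal_words_upto (n : nat) : seq word :=
  if n is n'.+1 then normal_words_upto n' ++ normal_words n else normal_words 0.

Lemma normal_words_uptoP (n : nat) (w : word) :
  w \in normal_words_upto n <-> normal w /\ (size w <= n)%N.
Proof.
elim: n => [|n IH] /=.
  by rewrite normal_wordsP leqn0; split=> -[? /eqP].
rewrite mem_cat; split=> [/orP[/IH[nw wn]|/normal_wordsP[nw ->]]|[nw]].
- by split=> //; apply: leqW.
- by [].
rewrite leq_eqVlt ltnS => /predU1P[wn|wn]; apply/orP.
  by right; apply/normal_wordsP.
by left; apply/IH.
Qed.

Lemma normal_words_upto_uniq (n : nat) : uniq (normal_words_upto n).
Proof.
elim: n => [|n IH] /=; first exact: normal_words_uniq.
rewrite cat_uniq IH normal_words_uniq andbT; apply/hasPn => w.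
move=> /normal_wordsP[_ wn]; apply/negP => /normal_words_uptoP[_].
by rewrite wn ltnn.
Qed.

Lemma size_normal_words_upto (n : nat) :
  size (normal_words_upto n) = (\sum_(i < n.+1) size (normal_words i))%N.
Proof.
elim: n => [|n IH] /=; first by rewrite big_ord1.
by rewrite big_ord_recr size_cat IH.
Qed.

Lemma growth_space_normal (n : nat) :
  growth_space s n.+1 `<=` lspan [set` map word_val (normal_words_upto n.+1)].
Proof.
move=> x /growth_space_words; apply: lspan_sub => [|_ [w wn <-]].
  exact: lspan_subspace.
apply: lspan_mono (@normal_span w) => _ [u [nu uw] <-].
by apply/map_f/normal_words_uptoP; rewrite -wn.
Qed.

Lemma growth_space_finite (n : nat) :
  1 \in s -> finite_dim (growth_space s n.+1).
Proof.
move=> s1; exists (map word_val (normal_words_upto n.+1)); apply/seteqP.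
split; first exact: growth_space_normal.
apply: lspan_sub; first exact: growth_space_subspace.
move=> _ /mapP[w /normal_words_uptoP[_ wn] ->].
exact: word_val_growth.
Qed.

Lemma growth_normal_words (n : nat) :
  1 \in s -> growth s n.+1 = size (normal_words_upto n.+1).
Proof.
move=> s1; apply/eqP; rewrite eqn_leq; apply/andP; split.
  by have := dimension_le (@growth_space_normal n); rewrite size_map.
rewrite -(card_seq_sub (normal_words_upto_uniq n.+1)).
apply: (dimension_ge (growth_space_finite n s1)).
  by apply: normal_free => w /normal_words_uptoP[].
move=> w; have /normal_words_uptoP[_ wn] := ssvalP w.
exact: word_val_growth.
Qed.

Lemma growth_linear_or_quadratic :
  1 \in s ->
  (exists C, forall n, (0 < n)%N -> (growth s n <= C * n)%N) \/
  (forall n, (0 < n)%N -> (n ^ 2 <= 2 * growth s n)%N).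
Proof.
move=> s1.
have [[d [d0 wd]]|nd] :=
  pselect (exists d, (0 < d)%N /\ (size (normal_words d) <= d)%N).
  (* [M] bounds the number of normal words of every length: the cube serves lengths from [d.*2] on,
     the sum serves the shorter ones. The factor 2 absorbs the [n + 2] lengths from 0 to [n + 1]. *)
  left; pose M := (d ^ 3 + \sum_(i < d.*2) size (normal_words i))%N.
  exists (2 * M)%N => -[//|n] _.
  rewrite growth_normal_words // size_normal_words_upto.
  apply: (@leq_trans (\sum_(i < n.+2) M)%N); last first.
    by rewrite sum_nat_const card_ord; nia.
  apply: leq_sum => i _; have [id|di] := ltnP i d.*2.
    by rewrite /M (bigD1 (Ordinal id)) //=; lia.
  apply: leq_trans (leq_addr _ _).
  apply: (@factor_closed_bound _ normal d i (normal_words d)) => //.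
  - exact: normal_factor.
  - by move=> w nw sw; apply/normal_wordsP.
  - exact: normal_words_uniq.
  - by move=> w /normal_wordsP.
right=> -[//|n] _; rewrite growth_normal_words //.
have big d : (d < size (normal_words d.+1))%N.
  by rewrite ltnNge; apply/negP => wd; apply: nd; exists d.+1; lia.
(* Length [m + 1] adds at least [m + 1] words, and [(m + 1) ^ 2 <= m ^ 2 + 2 * (m + 1)]. *)
elim: n.+1 => [//|m IH] /=; rewrite size_cat.
by have := big m; move: IH; rewrite -!mulnn; nia.
Qed.
End NormalWords.

(** * From Gelfand-Kirillov dimension 1 to linear growth *)

Lemma limn_esup_lt (R : realType) (u : nat -> \bar R) (a : \bar R) :
  (limn_esup u < a)%E -> exists N, forall n, (N <= n)%N -> (u n < a)%E.
Proof.
rewrite /limn_esup limf_esupE => /ereal_inf_lt[_ [V [N _ NV] <-] sup_lt].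
exists N => n Nn; apply: le_lt_trans sup_lt.
by apply: ereal_sup_ubound; exists n => //; apply: NV.
Qed.

Lemma growth_exponent1_linear (R : realType) (K : fieldType) (A : algType K)
    (s : seq A) :
  1 \in s -> growth_exponent R s = 1%:E ->
  exists C, forall n, (0 < n)%N -> (growth s n <= C * n)%N.
Proof.
move=> s1 g1; have [//|quad] := growth_linear_or_quadratic s1.
(* An exponent strictly between 1 and 2: it yields [f ^ 2 < n ^ 3], while quadratic growth yields
   [n ^ 4 <= 4 * f ^ 2], which is absurd once [n >= 4]. *)
have /limn_esup_lt[N uN] : (growth_exponent R s < (3 / 2)%:E)%E.
  by rewrite g1 lte_fin; lra.
pose n := maxn N 4; have n4 : (4 <= n)%N by rewrite leq_maxr.
have := uN n (leq_maxl _ _); rewrite lte_fin.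
set f := growth s n; have nf : (n ^ 2 <= 2 * f)%N by apply: quad; lia.
have f0 : (0 < f)%N by move: nf; rewrite -mulnn; nia.
have lnn : 0 < ln (n%:R : R) by rewrite ln_gt0 // ltr1n; lia.
rewrite ltr_pdivrMr // => lnf.
have : ln (f%:R ^+ 2 : R) < ln (n%:R ^+ 3 : R).
  by rewrite !lnXn ?ltr0n //; [lra | lia].
rewrite ltr_ln ?posrE ?exprn_gt0 ?ltr0n //; last by lia.
rewrite -!natrX ltr_nat => fn.
by exfalso; move: nf fn; rewrite !expnS expn0; nia.
Qed.

(** * Exhaustion of the algebra by growth spaces *)

Lemma growth_space_prod (K : fieldType) (A : algType K) (s : seq A)
    (m n : nat) (x y : A) :
  growth_space s m.+1 x -> growth_space s n.+1 y ->
  growth_space s (m + n).+2 (x * y).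
Proof.
move=> Sx; have mulL : linear (fun y => x * y).
  by move=> a u v; rewrite mulrDr scalerAr.
have sS k := subspace_preimage mulL (growth_space_subspace s k).
elim: n y => [|n IH] y.
  move=> Sy; rewrite addn0; apply: (lspan_sub (sS m.+1)) Sy => z /= zs.
  exact: growth_space_mul.
move=> Sy; apply: (growth_space_min (sS (m + n.+1).+1)) Sy => z t Sz ts /=.
rewrite addnS.
by rewrite mulrA; apply: growth_space_mul => //; apply: IH.
Qed.

(** The union of the growth spaces is a subalgebra containing the generators. *)
Lemma growth_space_cover (K : fieldType) (A : algType K) (s : seq A) (a : A) :
  generating_system s -> exists n, growth_space s n.+1 a.
Proof.
move=> [s1 sgen]; pose B := [set a : A | exists n, growth_space s n.+1 a].
have : smallest (fun B : set A => subalg_closed (mem B)) [set` s] a.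
  by rewrite sgen.
apply: (@smallest_sub _ _ _ B) => [|t /= ts]; last first.
  by exists 0%N; apply: sub_gen_smallest.
split=> [|c x y|x y]; rewrite !inE.
- by exists 0%N; apply: sub_gen_smallest.
- move=> [m Sx] [n Sy]; exists (maxn m n).
  have /is_subspaceP[_] := growth_space_subspace s (maxn m n); apply.
    by apply: growth_space_mono Sx => //; apply: leq_maxl.
  by apply: growth_space_mono Sy => //; apply: leq_maxr.
- by move=> [m Sx] [n Sy]; exists (m + n).+1; apply: growth_space_prod.
Qed.

Lemma growth_space_cover_seq (K : fieldType) (A : algType K) (s H : seq A) :
  generating_system s ->
  exists n, forall a, a \in H -> growth_space s n.+1 a.
Proof.
move=> sgen; have s1 := sgen.1; elim: H => [|h H [n HS]]; first by exists 0%N.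
have [m hS] := growth_space_cover h sgen.
exists (maxn m n) => a; rewrite inE => /predU1P[->|/HS aS].
  by apply: growth_space_mono hS => //; apply: leq_maxl.
by apply: growth_space_mono aS => //; apply: leq_maxr.
Qed.

(** * Ends *)

(** By uniqueness, any family with terms in the [V i] is the decomposition of its sum; linearity
    follows by combining two decompositions termwise. *)
Lemma direct_sum_projections (K : fieldType) (E : lmodType K) (k : nat)
    (V : 'I_k -> set E) :
  (forall i, is_subspace (V i)) -> is_direct_sum V ->
  exists p : 'I_k -> E -> E,
    [/\ forall i, linear (p i), forall i a, V i (p i a),
        forall a, a = \sum_i p i a
      & forall w : 'I_k -> E, (forall i, V i (w i)) ->
          forall i, p i (\sum_j w j) = w i].
Proof.
move=> sV /choice[v vP]; exists (fun i a => v a i).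
have uniq_v (w : 'I_k -> E) : (forall i, V i (w i)) ->
    forall i, v (\sum_j w j) i = w i.
  move=> Vw i; have [_ /(_ [ffun j => w j])] := vP (\sum_j w j).
  move=> -> ; first by rewrite ffunE.
  by split=> [j|]; [rewrite ffunE | apply: eq_bigr => j _; rewrite ffunE].
split=> // [i a x y|i a|a].
- have sum_v b : b = \sum_j v b j by case: (vP b) => -[].
  rewrite {1}(sum_v x) {1}(sum_v y) scaler_sumr -big_split /= uniq_v // => j.
  have /is_subspaceP[_] := sV j; apply; last by case: (vP y) => -[].
  by case: (vP x) => -[].
- by case: (vP a) => -[].
- by case: (vP a) => -[].
Qed.

(** Only finitely many pairs of a summand and a generator occur, so their defects fit into one
    finitely spanned space. *)
Lemma almost_invariant_defect (K : fieldType) (A : algType K) (k : nat)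
    (V : 'I_k -> set A) (s : seq A) :
  (forall i, almost_invariant (V i)) ->
  exists F : seq A, forall i v x, V i v -> x \in s ->
    exists2 u, lspan [set` F] u & V i (v * x - u).
Proof.
move=> aiV.
have /choice[G GP] (ix : 'I_k * A) : exists F : seq A, forall v, V ix.1 v ->
    exists2 u, lspan [set` F] u & V ix.1 (v * ix.2 - u).
  case: ix => i x /=; have [sV /(_ x)[F _ FP]] := aiV i.
  exists F => v Vv; apply: FP; exists v => //; exists 0; first exact: subspace0.
  by rewrite addr0.
exists (flatten [seq G (i, x) | i <- enum 'I_k, x <- s]) => i v x Vv xs.
have [u Gu Vu] := GP (i, x) v Vv; exists u => //.
apply: lspan_mono Gu => y /= yG; apply/flattenP; exists (G (i, x)) => //.
by apply: allpairs_f => //; rewrite mem_enum.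
Qed.

Lemma ends_growth (K : fieldType) (A : algType K) (s : seq A) (k : nat) :
  generating_system s -> ends_decomposition A k ->
  exists m, forall n, (k * n <= growth s (n + m).+1)%N.
Proof.
move=> sgen [V [aiV infV dV]]; have s1 := sgen.1.
have sV i : is_subspace (V i) by case: (aiV i).
have [p [pL Vp sum_p pE]] := direct_sum_projections sV dV.
have [F FP] := almost_invariant_defect s aiV.
(* [m] is chosen so that [S m] contains the defects, their projections and the projections of the
   generators. *)
have [m HS] := growth_space_cover_seq
  (F ++ [seq p i y | i <- enum 'I_k, y <- F ++ s]) sgen.
pose S n := growth_space s n.+1.
have sS n : is_subspace (S n) := growth_space_subspace s n.
have mS a b : (a <= b)%N -> S a `<=` S b by move=> ab; apply: growth_space_mono.
have pB i x y : p i (x - y) = p i x - p i y.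
  by rewrite -(scaleN1r y) addrC pL scaleN1r addrC.
have pV i x : V i x -> p i x = x.
  move=> Vx; have := pE (fun j => if j == i then x else 0).
  rewrite -big_mkcond big_pred1_eq => -> //; first by rewrite eqxx.
  by move=> j; case: eqP => [->//|_]; apply: subspace0.
pose D := lspan [set` F].
have sD : is_subspace D := lspan_subspace _.
have DS : D `<=` S m.
  by apply: (lspan_sub (sS m)) => x /= xF; apply: HS; rewrite mem_cat xF.
have pDS i x : D x -> S m (p i x).
  apply: (lspan_sub (subspace_preimage (pL i) (sS m))) => {}x /= xF.
  apply: HS; rewrite mem_cat; apply/orP; right; apply: allpairs_f => //.
    by rewrite mem_enum.
  by rewrite mem_cat xF.
(* Split [v] into its components [p j v]: each [p j v * x] lies in [V j] up to a defect [u j]. Then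
   [u] is the sum of these defects and [u'] is the one of index [i]. *)
have pmul i v x : x \in s -> exists u u', [/\ D u, D u' &
    p i (v * x) = p i v * x + (p i u - u')].
  move=> xs; have /choice[u uP] j : exists u, D u /\ V j (p j v * x - u).
    by have [u Du Vu] := FP j (p j v) x (Vp j v) xs; exists u.
  exists (\sum_j u j), (u i); split; [|exact: (uP i).1|].
    by apply: (subspace_sum sD) => j _; exact: (uP j).1.
  have vx : v * x - \sum_j u j = \sum_j (p j v * x - u j).
    by rewrite sumrB -mulr_suml -sum_p.
  rewrite -{1}(subrK (\sum_j u j) (v * x)) vx addrC.
  rewrite -(scale1r (\sum_j u j)) pL scale1r.
  rewrite (pE (fun j => p j v * x - u j)) => [|j]; last first.
    exact: (uP j).2.
  by rewrite scale1r addrCA.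
(* The index rises by [m] only once, because the error made at each multiplication stays in
   [S m]. *)
have pS i n : S n `<=` p i @^-1` S (n + m)%N.
  elim: n => [|n IH].
    rewrite add0n; apply: (lspan_sub (subspace_preimage (pL i) (sS m))) => x xs.
    apply: HS; rewrite mem_cat; apply/orP; right; apply: allpairs_f => //.
      by rewrite mem_enum.
    by rewrite mem_cat xs orbT.
  apply: (growth_space_min (subspace_preimage (pL i) (sS (n.+1 + m)%N))).
  move=> v x Sv xs /=; have [u [u' [Du Du' ->]]] := pmul i v x xs.
  apply: (subspaceD (sS _)).
    by rewrite addSn; apply: growth_space_mul => //; apply: IH.
  apply: (mS m); first exact: leq_addl.
  by apply: (subspaceB (sS _)); [apply: pDS | apply: DS].
pose U i n := p i @` S n.
have sU i n : is_subspace (U i n) := subspace_image (pL i) (sS n).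
(* If [p i] maps [S n.+1] into the image of [S n], then this image is stable
   and exhausts [V i], which is infinite dimensional. *)
have grow i n : (m <= n)%N -> exists2 e, S n.+1 e & ~ U i n (p i e).
  move=> mn; apply: contrapT => nex.
  have stab e : S n.+1 e -> U i n (p i e).
    by move=> Se; apply: contrapT => ne; apply: nex; exists e.
  have sQ : is_subspace (p i @^-1` U i n) := subspace_preimage (pL i) (sU i n).
  have allS l : S (n + l)%N `<=` p i @^-1` U i n.
    elim: l => [|l IH]; first by rewrite addn0 => e /(mS _ _ (leqnSn n)) /stab.
    rewrite addnS; apply: (growth_space_min sQ) => v x Sv xs /=.
    have [w Sw pw] := IH v Sv.
    have [u [u' [Du Du' pvx]]] := pmul i v x xs.
    have [z [z' [Dz Dz' pwx]]] := pmul i w x xs.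
    (* With [p i v = p i w], the two products differ only by defects. The difference lies in [V i],
       so applying [p i] leaves it unchanged and turns it into [p i d]. *)
    pose d := u - u' - (z - z').
    have Dd : D d by do !apply: (subspaceB sD).
    have pd : p i (v * x) - p i (w * x) = p i d.
      rewrite -(pV i (_ - _)); last exact: (subspaceB (sV i)).
      by rewrite pvx pwx pw opprD addrACA subrr add0r !pB !(pV i (p i _)).
    rewrite -(subrK (p i (w * x)) (p i (v * x))) pd.
    apply: (subspaceD (sU i n)); last by apply: stab; apply: growth_space_mul.
    by exists d => //; apply: (mS _ _ mn); apply: DS.
  have [b [_ _ Sb]] := dimension_basis (growth_space_finite n s1).
  apply: (infV i); exists (map (p i) b); apply/seteqP; split=> [x Vx|]; last first.
    by apply: (lspan_sub (sV i)) => _ /mapP[y _ ->].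
  have [l Sx] := growth_space_cover x sgen.
  have [w Sw] : U i n (p i x) by apply: (allS l); apply: (mS l _ (leq_addl _ _)).
  rewrite (pV i x Vx) => <-; move: Sw; rewrite /S Sb.
  apply: (lspan_sub (subspace_preimage (pL i) (lspan_subspace _))) => y /= yb.
  by apply: sub_gen_smallest; apply: map_f.
have /choice[e eP] (ir : 'I_k * nat) :
    exists e, S (m + ir.2).+1 e /\ ~ U ir.1 (m + ir.2)%N (p ir.1 e).
  by have [e Se eU] := grow ir.1 _ (leq_addr ir.2 m); exists e.
(* One [m] is the index where strict growth starts, the other the shift caused by [p i]. *)
exists (m + m)%N => n; rewrite -[k]card_ord -[n in (_ * n)%N]card_ord -card_prod.
apply: (dimension_ge (growth_space_finite _ s1)
  (e := fun ir : 'I_k * 'I_n => p ir.1 (e (ir.1, val ir.2)))) => [c c0 [i r]|[i r]].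
  (* Applying [p i] to the relation isolates the terms of index [i], which are free by the
     filtration [U i]. *)
  apply: (@free_family_filtration _ _ _ (fun r : 'I_n => p i (e (i, val r))) val
    (fun r => U i (m + r)%N) val_inj _ _ _ (fun r => c (i, r)) _ r)
    => {r} [r|r r' rr'|r|].
  - exact: sU.
  - exists (e (i, val r)) => //.
    apply: (mS (m + r).+1); last exact: (eP (i, val r)).1.
    by rewrite -addnS leq_add2l.
  - exact: (eP (i, val r)).2.
  rewrite -(pE (fun i => \sum_r c (i, r) *: p i (e (i, val r)))) => [|j].

    rewrite pair_bigA /= [X in p i X](_ : _ = 0) ?pV //; first exact: subspace0.
    by rewrite -[RHS]c0; apply: eq_bigr => -[].
  by apply: (subspace_sum (sV j)) => r _; apply: (subspaceZ (sV j)).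
apply: (mS (m + n + m)%N); first by lia.
apply: pS; apply: (mS (m + r).+1); last exact: (eP (i, val r)).1.
by have := ltn_ord r; lia.
Qed.

Lemma ends_decomposition1 (K : fieldType) (A : algType K) :
  ~ finite_dim [set: A] -> ends_decomposition A 1.
Proof.
move=> infA; exists (fun=> setT); split=> // [i|a].
  split; first exact/is_subspaceP.
  move=> x; exists [::] => // w _; exists 0 => //.
  exact: (subspace0 (lspan_subspace _)).
exists [ffun=> a]; split=> [|v [_ ->]]; first by split; rewrite // big_ord1 ffunE.
by apply/ffunP => i; rewrite ffunE big_ord1 (ord1 i).
Qed.

Lemma linear_growth_at_most_ends (R : realType) (K : fieldType) (A : algType K)
    (C : R) (s : seq A) :
  generating_system s ->
  (forall n : nat, (1 <= n)%N -> (growth s n)%:R <= C * n%:R) ->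
  at_most_ends A C.
Proof.
move=> sgen gC.
have bound k : ends_decomposition A k -> k%:R <= C.
  move=> /(ends_growth sgen)[m kg].
  (* From [k * n <= f(n + m + 1) <= C * (n + m + 1)]; for [k > C] the left side would be unbounded
     in [n]. *)
  have kn n : (k%:R - C) * n%:R <= C * m.+1%:R.
    have := gC (n + m).+1 isT; rewrite -addnS natrD mulrDr => gCn.
    by rewrite mulrBl lerBlDl (le_trans _ gCn) // -natrM ler_nat addnS kg.
  rewrite leNgt; apply/negP; rewrite -subr_gt0 => kC.
  have := kn (Num.bound `|C * m.+1%:R / (k%:R - C)|); apply/negP; rewrite -ltNge.
  by rewrite -ltr_pdivrMl // mulrC (le_lt_trans (ler_norm _)) ?archi_boundP.
(* The bound at [n = 1] settles the case of zero ends and makes [Num.bound C] exceed [C]. *)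
have C0 : 0 <= C by have := gC 1%N isT; rewrite mulr1; apply: le_trans.
split=> [|[|k] //= [/bound]//].
have [finA|infA] := pselect (finite_dim [set: A]); first by exists 0%N.
have [n nP] : exists n, ~~ `[< ends_decomposition A n.+1 >].
  exists (Num.bound C); apply/asboolPn => /bound; apply/negP; rewrite -ltNge.
  by rewrite (lt_trans (archi_boundP C0)) // ltr_nat.
have ex : exists n, ~~ `[< ends_decomposition A n.+1 >] by exists n.
(* The least [n] without a decomposition into [n + 1] summands is the number of ends; it is positive
   because the infinite dimensional algebra is itself a single summand. *)
case: (ex_minnP ex) => -[|k] /asboolPn nk kmin.
  by exfalso; apply/nk/ends_decomposition1.
exists k.+1; split=> //; apply: contrapT => nk'.
by have /asboolPn/kmin := nk'; rewrite ltnn.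
Qed.

Theorem theorem3 (R : realType) (K : fieldType) (A : algType K)
    (Afg : finitely_generated A) :
  (has_GKdim A (1%:E : \bar R) -> finitely_many_ends A) /\
  (forall (C : R) (s : seq A),
     generating_system s ->
     (forall n : nat, (1 <= n)%N -> (growth s n)%:R <= C * n%:R) ->
     at_most_ends A C).
Proof.
split=> [[s sgen /(growth_exponent1_linear sgen.1)[C gC]]|].
  have [|//] := @linear_growth_at_most_ends R K A C%:R s sgen.
  by move=> n n0; rewrite -natrM ler_nat; apply: gC.
exact: linear_growth_at_most_ends.
Qed.
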